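(* (a) Let $(V,\langle\cdot,\cdot\rangle)$ be a nondegenerate orthogonal space of dimension $n$ over a field $\mathbb{K}$. If $\xi,\eta,\alpha$ are subspaces of $V$ and $\xi\bot\eta$, then $$\dim\big(((\eta^\bot\cap\alpha)+\xi)/\xi\big)+\dim\big(((\xi^\bot\cap\alpha^\bot)+\eta)/\eta\big)=n-\dim\eta-\dim\xi.$$ (b) In particular, if $\xi$ is an isotropic subspace ($\xi\subset\xi^\bot$), then $$\dim\big(((\xi^\bot\cap\alpha)+\xi)/\xi\big)+\dim\big(((\xi^\bot\cap\alpha^\bot)+\xi)/\xi\big)=\dim\xi^\bot-\dim\xi=n-2\dim\xi.$$
   Context: An orthogonal space is a finite-dimensional vector space $V$ over a field $\mathbb{K}$ equipped with a form $\langle\cdot,\cdot\rangle:V\times V\to\mathbb{K}$ of one of three types: bilinear symmetric; bilinear antisymmetric; or $\mathbb{K}=\mathbb{C}$ and the form is Hermitian (sesquilinear). For a subspace $\lambda\subset V$, $\lambda^\bot=\{x\in V\mid\langle x,y\rangle=0\ \text{for all }y\in\lambda\}$. The space is nondegenerate if $V^\bot=\{0\}$. For subspaces, $\lambda\bot\mu$ means $\lambda\subset\mu^\bot$ (equivalently $\mu\subset\lambda^\bot$). *)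

(* Defs.v *)
From HB Require Import structures.
From mathcomp Require Import all_boot all_order all_algebra.
From mathcomp Require Export sesquilinear.
From mathcomp Require Import reals complex.

Set Implicit Arguments.
Unset Strict Implicit.
Unset Printing Implicit Defensive.

Import GRing.Theory VectorInternalTheory.
Local Open Scope ring_scope.
Local Open Scope quotient_scope.

(* The quotient vector space V / W. Its carrier is the Z-module quotient      *)
(* {quot W} of ring_quotient; scaling and finite dimension are added here.    *)
Section QuotientSpace.
Variables (K : fieldType) (V : vectType K) (W : {vspace V}).

Definition quotv_of : Type := Quotient.quot W.

HB.instance Definition _ := GRing.Zmodule.on quotv_of.

Definition quotv_pi (v : V) : quotv_of := \pi_(Quotient.quot W) v.
Let rep (x : quotv_of) : V := repr (x : Quotient.quot W).

Lemma eq_quotv_pi u v : (quotv_pi u == quotv_pi v) = (u - v \in W).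
Proof. by rewrite Quotient.idealrBE. Qed.

Let repK x : quotv_pi (rep x) = x. Proof. exact: reprK. Qed.

Let piB u v : quotv_pi (u - v) = quotv_pi u - quotv_pi v.
Proof. by rewrite /quotv_pi !piE. Qed.

Let piD u v : quotv_pi (u + v) = quotv_pi u + quotv_pi v.
Proof. by rewrite /quotv_pi !piE. Qed.

Definition quotv_scale (a : K) (x : quotv_of) : quotv_of := quotv_pi (a *: rep x).

Lemma quotv_scale_pi a v : quotv_scale a (quotv_pi v) = quotv_pi (a *: v).
Proof.
apply/eqP; rewrite eq_quotv_pi -scalerBr rpredZ //.
by rewrite -eq_quotv_pi repK.
Qed.

Fact quotv_scaleA a b x :
  quotv_scale a (quotv_scale b x) = quotv_scale (a * b) x.
Proof. by rewrite -[x]repK !quotv_scale_pi scalerA. Qed.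

Fact quotv_scale1 : left_id 1 quotv_scale.
Proof. by move=> x; rewrite -[x]repK quotv_scale_pi scale1r. Qed.

Fact quotv_scaleDr : right_distributive quotv_scale +%R.
Proof.
move=> a x y; rewrite -[x]repK -[y]repK -piD !quotv_scale_pi -piD.
by rewrite scalerDr.
Qed.

Fact quotv_scaleDl x : {morph quotv_scale^~ x : a b / a + b}.
Proof. by move=> a b; rewrite -[x]repK !quotv_scale_pi -piD scalerDl. Qed.

HB.instance Definition _ := GRing.Zmodule_isLmodule.Build K quotv_of
  quotv_scaleA quotv_scale1 quotv_scaleDr quotv_scaleDl.

Fact quotv_pi_is_linear : linear quotv_pi.
Proof. by move=> a u v; rewrite piD -quotv_scale_pi. Qed.

HB.instance Definition _ :=
  GRing.isLinear.Build K V quotv_of _ quotv_pi quotv_pi_is_linear.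

Let cpi : 'End(V) := daddv_pi W^C W.

Let capCW : (W^C :&: W = 0)%VS. Proof. by rewrite capvC capv_compl. Qed.

Let cpi_sub v : v - cpi v \in W.
Proof.
rewrite -{1}[v](daddv_pi_add capCW) ?[(_ + W)%VS]addvC ?addv_complf ?memvf //.
by rewrite addrC addKr memv_pi.
Qed.

Let cpi_ker v : v \in W -> cpi v = 0.
Proof.
move=> Wv; apply/eqP; rewrite -memv0 -capCW memv_cap memv_pi /=.
by rewrite -[cpi v](subKr v) rpredB ?cpi_sub.
Qed.

Fact quotv_vect_iso : Vector.axiom (dim (subvs_of W^C)) quotv_of.
Proof.
have cpi_rep v : cpi (rep (quotv_pi v)) = cpi v.
  apply/eqP; rewrite -subr_eq0 -linearB /= cpi_ker //.
  by rewrite -eq_quotv_pi repK.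
exists (fun x => v2r (vsproj W^C (cpi (rep x)))) => [a x y|].
  rewrite -[x in LHS]repK -[y in LHS]repK -linearP cpi_rep.
  by rewrite !linearP.
exists (fun r => quotv_pi (vsval (r2v r : subvs_of W^C))) => [x|r].
  rewrite v2rK vsprojK ?memv_pi // -[RHS]repK.
  by apply/eqP; rewrite eq_quotv_pi -opprB rpredN cpi_sub.
by rewrite cpi_rep daddv_pi_id ?subvsP // vsvalK r2vK.
Qed.

HB.instance Definition _ :=
  Lmodule_hasFinDim.Build K quotv_of quotv_vect_iso.

(* U / W as a subspace of V / W: the image of U under the projection. *)
Definition quotv (U : {vspace V}) : {vspace quotv_of} :=
  (linfun quotv_pi @: U)%VS.

End QuotientSpace.

Notation "U / W" := (quotv W U) : vspace_scope.

(* The three admissible types of forms, as pairs (eps, theta) such that       *)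
(* form x y = (-1) ^+ eps * theta (form y x), form being linear in its first  *)
(* and theta-linear in its second argument. C is R[i] for R a field of reals. *)
Inductive orthogonal_type : forall K : fieldType, bool -> {rmorphism K -> K} -> Prop :=
| BilinearSymmetric (K : fieldType) : @orthogonal_type K false idfun
| BilinearAntisymmetric (K : fieldType) : @orthogonal_type K true idfun
| ComplexHermitian (R : realType) : @orthogonal_type R[i] false (@conjc R).

(* Main.v *)
(* Passing to the dimensions of the subspaces upstairs, the identity reduces   *)
(* to Grassmann's formula for alpha + xi and alpha + eta^_|_, once one knows   *)
(* that dim U^_|_ = n - dim U. Counting linear equations gives >=; for <=, a   *)
(* vector of U orthogonal to a complement W of U^_|_ is orthogonal to the      *)
(* whole space, so that dim U <= dim W by the same count.                      *)

Require Import Defs.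
From mathcomp Require Import all_boot all_order all_algebra zify.

Set Implicit Arguments.
Unset Strict Implicit.
Unset Printing Implicit Defensive.

Import GRing.Theory.
Local Open Scope ring_scope.

(** By [dim_quotv_addv], each quotient has the dimension of its numerator minus that of an
    intersection. As xi lies in eta^_|_ and eta in xi^_|_, the intersections are alpha :&: xi and
    (alpha + eta^_|_)^_|_, while xi^_|_ :&: alpha^_|_ is (alpha + xi)^_|_. After [dim_orthov],
    Grassmann cancels dim alpha and leaves dim eta^_|_ - dim xi. *)

Section QuotientDimension.
Variables (K : fieldType) (V : vectType K).
Implicit Types U W : {vspace V}.

Lemma lker_quotv_pi W : lker (linfun (@quotv_pi K V W)) = W.
Proof.
apply/vspaceP=> v; rewrite memv_ker lfunE /=.
by rewrite -(linear0 (@quotv_pi K V W)) eq_quotv_pi subr0.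
Qed.

(** [U] need not contain [W]: the projection restricted to [U] has kernel [U :&: W]. *)
Lemma dim_quotv U W : (\dim (U / W) + \dim W)%N = \dim (U + W).
Proof.
have := limg_ker_dim (linfun (@quotv_pi K V W)) U.
rewrite lker_quotv_pi -/(quotv W U) => dimU.
(* lia does not see through the coercion marker inserted by the type V / W. *)
by rewrite /reverse_coercion; have := dimv_sum_cap U W; lia.
Qed.

Lemma dim_quotv_addv U W :
  (\dim ((U + W) / W) + \dim (U :&: W))%N = \dim U.
Proof.
have := dim_quotv (U + W) W; rewrite -addvA addvv => dimUW.
by have := dimv_sum_cap U W; lia.
Qed.

End QuotientDimension.

Section OrthogonalDimension.
Variables (K : fieldType) (eps : bool) (theta : {rmorphism K -> K}).
Variables (V : vectType K) (form : {hermitian V for eps & theta}).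
Implicit Types U W : {vspace V}.

Lemma orthov_addv U W : orthov form (U + W) = (orthov form U :&: orthov form W)%VS.
Proof. by apply/subv_anti; rewrite subv_cap -orthovD subvv orthovD -subv_cap subvv. Qed.

(** Each vector of a basis of [U] imposes one linear equation on [W], costing at most one
    dimension. *)
Lemma leq_dim_cap_orthov U W :
  (\dim W <= \dim (W :&: orthov form U) + \dim U)%N.
Proof.
have leq_span (X : seq V) :
    (\dim W <= \dim (W :&: orthov form <<X>>) + size X)%N.
  elim: X => [|x X IH] /=; first by rewrite span_nil orthov0 capvf addn0.
  rewrite span_cons addvC orthov_addv capvA.
  by have := leq_dim_orthov1 form x (W :&: orthov form <<X>>); lia.
by have := leq_span (vbasis U); rewrite (span_basis (vbasisP U)) size_tuple.
Qed.

Hypothesis form_nondeg : nondegenerate form.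

Lemma dim_orthov U : (\dim (orthov form U) + \dim U)%N = \dim {:V}.
Proof.
have leq_codim := leq_dim_cap_orthov U fullv; rewrite capfv in leq_codim.
set W := (orthov form U)^C%VS.
have UW0 : (U :&: orthov form W = 0)%VS.
  apply/eqP; rewrite -subv0 -(eqP form_nondeg) -(addv_complf (orthov form U)).
  by rewrite orthov_addv capvS // orthov_sym.
have := leq_dim_cap_orthov W U; rewrite UW0 dimv0 dimv_compl.
by have := dimvS (subvf (orthov form U)); lia.
Qed.

(** Symmetry of orthogonality gives one inclusion, and [dim_orthov] applied twice gives equal
    dimensions. *)
Lemma orthovK U : orthov form (orthov form U) = U.
Proof.
apply/esym/eqP; rewrite eqEdim orthov_sym subvv /=.
by have := dim_orthov U; have := dim_orthov (orthov form U); lia.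
Qed.

Lemma dim_quotv_orthov xi eta alpha : (xi <= orthov form eta)%VS ->
  (\dim ((orthov form eta :&: alpha + xi) / xi)
   + \dim ((orthov form xi :&: orthov form alpha + eta) / eta)
   + \dim eta + \dim xi)%N = \dim {:V}.
Proof.
move=> xi_eta; have eta_xi : (eta <= orthov form xi)%VS by rewrite orthov_sym.
have xi_cap : (orthov form eta :&: alpha :&: xi = alpha :&: xi)%VS.
  by rewrite capvC capvA (capv_idPl xi_eta) capvC.
(* Double orthogonality turns eta into (eta^_|_)^_|_, making the intersection a single
   orthogonal. *)
have eta_cap : (orthov form xi :&: orthov form alpha :&: eta
                = orthov form (alpha + orthov form eta))%VS.
  by rewrite capvC capvA (capv_idPl eta_xi) orthov_addv orthovK capvC.
have := dim_quotv_addv (orthov form eta :&: alpha) xi; rewrite xi_cap.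
have := dim_quotv_addv (orthov form xi :&: orthov form alpha) eta.
rewrite eta_cap -orthov_addv [(xi + alpha)%VS]addvC.
have := dim_orthov (alpha + xi); have := dim_orthov (alpha + orthov form eta).
have := dimv_sum_cap alpha xi; have := dimv_sum_cap alpha (orthov form eta).
rewrite [(alpha :&: orthov form eta)%VS]capvC.
by have := dim_orthov eta; lia.
Qed.

End OrthogonalDimension.

Theorem theorem3p15
  (K : fieldType) (eps : bool) (theta : {rmorphism K -> K})
  (form_type : orthogonal_type eps theta)
  (V : vectType K) (form : {hermitian V for eps & theta})
  (form_nondeg : nondegenerate form)
  (n : nat) (dimV : \dim {:V} = n) :
  (forall xi eta alpha : {vspace V},
     (xi <= orthov form eta)%VS ->
     (\dim ((orthov form eta :&: alpha + xi) / xi))%:Z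
     + (\dim ((orthov form xi :&: orthov form alpha + eta) / eta))%:Z
     = n%:Z - (\dim eta)%:Z - (\dim xi)%:Z)
  /\
  (forall xi alpha : {vspace V},
     (xi <= orthov form xi)%VS ->
     (\dim ((orthov form xi :&: alpha + xi) / xi))%:Z
     + (\dim ((orthov form xi :&: orthov form alpha + xi) / xi))%:Z
     = (\dim (orthov form xi))%:Z - (\dim xi)%:Z
     /\ (\dim (orthov form xi))%:Z - (\dim xi)%:Z
     = n%:Z - 2 * (\dim xi)%:Z).
Proof.
rewrite -dimV; split=> [xi eta alpha xi_eta | xi alpha xi_xi].
  by have := dim_quotv_orthov form_nondeg alpha xi_eta; lia.
(* Isotropy of [xi] is the hypothesis of the first part with eta = xi. *)
have := dim_quotv_orthov form_nondeg alpha xi_xi.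
by have := dim_orthov form_nondeg xi; lia.
Qed.
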